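(* Let $G$ be a finite simple loopless graph with vertices $v_1,\ldots,v_n$ and edge weights $\operatorname{wg}(e)\in\mathbb{Z}[w,r]$, let $M$ be its weighted adjacency matrix, and let $X=\operatorname{diag}(x_1,\ldots,x_n)$ with $x_1,\ldots,x_n$ commuting indeterminates over $\mathbb{Z}[w,r]$. Let $k\ge 3$ and let $\mathcal{C}_k(G)$ denote the set of unoriented simple cycles of length $k$ in $G$. Then $$\operatorname{SF}\!\left(\operatorname{tr}\bigl((XM)^k\bigr)\right)=2k\sum_{C\in\mathcal{C}_k(G)}\operatorname{wg}(C)\prod_{v_i\in V(C)}x_i .$$ Consequently, if $C_k(M)=\sum_{C\in\mathcal{C}_k(G)}\operatorname{wg}(C)$ denotes the total weight of the simple $k$-cycles, then $$C_k(M)=\frac{1}{2k}\,\operatorname{sq}\!\left(\operatorname{tr}\bigl((XM)^k\bigr)\right).$$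
   Context: The weighted adjacency matrix $M=(m_{ij})_{i,j=1}^n$ of $G$ is the symmetric matrix with $m_{ij}=\operatorname{wg}(e)$ if $v_i,v_j$ are joined by an edge $e$, and $m_{ij}=0$ otherwise (in particular $m_{ii}=0$). For a cycle $C$ in $G$, $\operatorname{wg}(C)=\prod_{e\in E(C)}\operatorname{wg}(e)$. For a polynomial $P=\sum_\alpha c_\alpha x^\alpha\in\mathbb{Z}[w,r][x_1,\ldots,x_n]$, its squarefree part is $\operatorname{SF}(P)=\sum_{\alpha\in\{0,1\}^n}c_\alpha x^\alpha$ (delete every monomial divisible by some $x_i^2$), and the squarefree extraction is $\operatorname{sq}(P)=\operatorname{SF}(P)|_{x_1=\cdots=x_n=1}\in\mathbb{Z}[w,r]$, i.e. the sum of the coefficients of all squarefree monomials of $P$. *)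

(* Defs.v *)
From HB Require Import structures.
From mathcomp Require Import all_boot all_order all_algebra.
From mathcomp Require Import mpoly.

Set Implicit Arguments.
Unset Strict Implicit.
Unset Printing Implicit Defensive.

Import GRing.Theory.
Local Open Scope ring_scope.

Section SquareFree.
Variables (n : nat) (R : comNzRingType).
Implicit Type P : {mpoly R[n]}.

Definition SF P : {mpoly R[n]} :=
  \sum_(m <- msupp P | [forall i, (m i <= 1)%N]) P@_m *: 'X_[m].

Definition sq P : R := (SF P).@[fun=> 1].

End SquareFree.

Section Cycles.
Variables (n : nat) (adj : rel 'I_n).

(* An edge is the two-element set of its endpoints.  The tuple [t] is read
   cyclically: [next t] sends the last vertex back to the first one. *)
Definition cycle_edges (t : seq 'I_n) : {set {set 'I_n}} :=
  [set [set x; next t x] | x in t].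

(* An unoriented, unrooted simple cycle is identified with its edge set, so
   that the 2k rooted orientations of a k-cycle (k >= 3) give one element;
   its vertex set is then [cover C]. *)
Definition simple_cycles (k : nat) : {set {set {set 'I_n}}} :=
  [set C | [exists t : k.-tuple 'I_n,
     [&& uniq t, cycle adj t & C == cycle_edges t]]].

End Cycles.

Section Weights.
Variables (n : nat) (R : comNzRingType).
Variables (adj : rel 'I_n) (wg : {set 'I_n} -> R).

(* Only the values of [wg] at edges matter: [wg] is consulted at no other set
   here nor in the weight of a cycle. *)
Definition wadj : 'M[R]_n :=
  \matrix_(i, j) if adj i j then wg [set i; j] else 0.

Definition cycle_weight (C : {set {set 'I_n}}) : R := \prod_(f in C) wg f.

Definition total_cycle_weight (k : nat) : R :=
  \sum_(C in simple_cycles adj k) cycle_weight C.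

Definition Xmx : 'M[{mpoly R[n]}]_n := diag_mx (\row_i 'X_i).

Definition XM : 'M[{mpoly R[n]}]_n := Xmx *m map_mx (@mpolyC n R) wadj.

End Weights.

Notation Zwr := {mpoly int[2]}.
Notation Qwr := {mpoly rat[2]}.

Definition Zwr_to_Qwr (p : Zwr) : Qwr := map_mpoly (intr : int -> rat) p.

(* Main.v *)
(* The trace of (XM)^k is the sum over closed walks t of length k of the weight
   of t times the product of the x_i along t, so its squarefree part keeps
   exactly the walks without repeated vertex, i.e. the rooted oriented simple
   cycles.  For k >= 3 each cycle C arises from exactly 2k of them: if t and s
   have the same edge set and common first vertex x, then t leaves x along one
   of the two edges of s at x, and from then on, a walk that does not turn back
   has only one way to go, so t is a rotation of s or of its reversal. *)
Require Import Defs.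
From HB Require Import structures.
From mathcomp Require Import all_boot all_order all_algebra.
From mathcomp Require Import mpoly.

Set Implicit Arguments.
Unset Strict Implicit.
Unset Printing Implicit Defensive.

Import GRing.Theory.
Local Open Scope ring_scope.

Lemma set2_inj_l (T : finType) (x y z : T) :
  y != x -> [set x; y] = [set x; z] -> y = z.
Proof.
move=> yx /setP/(_ y); rewrite !inE eqxx orbT (negbTE yx) /=.
by move/esym/eqP.
Qed.

(** * Successors along a duplicate-free cycle *)

Section UniqCycles.
Variable T : eqType.
Implicit Types (s t : seq T) (x y : T).

Lemma uniq_next_neq s x :
  uniq s -> (1 < size s)%N -> x \in s -> next s x != x.
Proof.
move=> us sz xs; have [i s' def_s] := rot_to xs.
rewrite -(next_rot i us); move: us sz; rewrite -(rot_uniq i) -(size_rot i s) def_s.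
by case: s' {def_s} => //= y s'; rewrite eqxx inE negb_or eq_sym => /andP[/andP[]].
Qed.

(** The form in which a length of at least three is used: such a cycle never turns back, so the two
    neighbours of a vertex on it are distinct. *)
Lemma uniq_next2_neq s x :
  uniq s -> (2 < size s)%N -> x \in s -> next s (next s x) != x.
Proof.
move=> us sz xs; have [i s' def_s] := rot_to xs.
rewrite -!(next_rot i us); move: us sz; rewrite -(rot_uniq i) -(size_rot i s) def_s.
case: s' {def_s} => [|y [|z s']] //=.
rewrite !inE !negb_or => /andP[/and3P[xy xz _] _] _.
by rewrite eqxx (eq_sym y) (negbTE xy) eqxx eq_sym.
Qed.

Lemma next_inj s : uniq s -> injective (next s).
Proof. by move=> us; apply: can_inj (prev_next us). Qed.

Lemma fpath_rcons_map (f : T -> T) x s y :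
  fpath f x (rcons s y) -> rcons s y = map f (x :: s).
Proof. by elim: s x => [|z s IHs] x /= /andP[/eqP<-] // /IHs->. Qed.

Lemma rot1_next s : uniq s -> rot 1 s = map (next s) s.
Proof.
case: s => // x s us; rewrite rot1_cons.
by apply: fpath_rcons_map; apply: cycle_next us.
Qed.

(** Makes a duplicate-free cycle recoverable from its head, its length and [next], so that two
    cycles can be compared through their successor maps. *)
Lemma uniq_traject s x t :
  s = x :: t -> uniq s -> s = traject (next s) x (size s).
Proof.
move=> -> us /=; congr (_ :: _); apply: fpathE.
have := cycle_next us; rewrite /= rcons_path => /andP[] //.
Qed.

End UniqCycles.

(** * Cycles with a given edge set *)

Section CycleEdges.
Variable n : nat.
Implicit Types (s t : seq 'I_n) (x y : 'I_n).

Lemma cycle_edges_rot i s :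
  uniq s -> cycle_edges (rot i s) = cycle_edges s.
Proof.
move=> us; apply/setP=> e; apply/imsetP/imsetP=> -[x xs ->]; exists x.
- by rewrite mem_rot in xs.
- by rewrite next_rot.
- by rewrite mem_rot.
- by rewrite next_rot.
Qed.

Lemma cycle_edges_rev s : uniq s -> cycle_edges (rev s) = cycle_edges s.
Proof.
move=> us; apply/setP=> e; apply/imsetP/imsetP=> -[x].
  rewrite mem_rev => xs ->; exists (prev s x); rewrite ?mem_prev //.
  by rewrite next_rev // next_prev // setUC.
move=> xs ->; exists (next s x); rewrite ?mem_rev ?mem_next //.
by rewrite next_rev // prev_next // setUC.
Qed.

Lemma cover_cycle_edges s : cover (cycle_edges s) = [set x in s].
Proof.
apply/setP=> x; rewrite inE; apply/bigcupP/idP => [[e]|xs].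
  by case/imsetP=> y ys ->; rewrite !inE => /orP[]/eqP-> //; rewrite mem_next.
by exists [set x; next s x]; [apply: imset_f | rewrite !inE eqxx].
Qed.

(** Two distinct vertices yielding the same edge would be each other's successors, and the cycle
    would turn back. Hence a product over the edge set counts each step once. *)
Lemma cycle_edges_inj s : uniq s -> (2 < size s)%N ->
  {in s &, injective (fun x => [set x; next s x])}.
Proof.
move=> us sz x y xs ys exy.
have: x \in [set y; next s y] by rewrite -exy !inE eqxx.
rewrite !inE => /orP[/eqP //|/eqP ex].
have ney := uniq_next2_neq us sz ys.
move: exy; rewrite ex [RHS]setUC => /set2_inj_l exy.
case/eqP: ney; apply: exy; rewrite uniq_next_neq ?mem_next //.
by apply: ltnW.
Qed.

(** The edge by which [t] leaves [next t x] is one of the two edges of [s] there; the one leading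
    back to [x] is excluded because [t] does not turn back. *)
Lemma cycle_edges_step s t x : uniq s -> uniq t -> (2 < size t)%N ->
  cycle_edges t = cycle_edges s -> x \in t ->
  next t x = next s x -> next t (next t x) = next s (next s x).
Proof.
move=> us ut sz est xt enx; rewrite -enx; set y := next t x.
have yt : y \in t by rewrite mem_next.
have : [set y; next t y] \in cycle_edges s by rewrite -est; apply: imset_f.
have neqy : next t y != y by apply: uniq_next_neq; rewrite // ltnW.
case/imsetP=> u us' eyu.
have: y \in [set u; next s u] by rewrite -eyu !inE eqxx.
rewrite !inE => /orP[/eqP yu|/eqP yu].
  by rewrite -yu in eyu; apply: set2_inj_l eyu.
have xu : u = x by apply: (next_inj us); rewrite -yu -enx.
move: eyu; rewrite yu [RHS]setUC -yu => /(set2_inj_l neqy).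
by rewrite xu => /eqP; rewrite (negbTE (uniq_next2_neq ut sz xt)).
Qed.

Lemma cycle_edges_same_start s t x s' t' : s = x :: s' -> t = x :: t' ->
  uniq s -> uniq t -> (2 < size t)%N -> size s = size t ->
  cycle_edges t = cycle_edges s -> next t x = next s x -> t = s.
Proof.
move=> ds dt us ut sz esz est enx.
rewrite (uniq_traject dt ut) (uniq_traject ds us) esz.
(* Two consecutive agreements are carried along, since [cycle_edges_step] starts from a common
   vertex with a common successor. *)
suff it i : [/\ iter i (next t) x = iter i (next s) x,
                iter i.+1 (next t) x = iter i.+1 (next s) x
              & iter i (next t) x \in t].
  apply: (@eq_from_nth _ x); rewrite ?size_traject // => i lti.
  by rewrite !nth_traject //; case: (it i).
elim: i => [|i [IH1 IH2 IH3]] /=; first by rewrite dt mem_head -dt.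
split=> //=; last by rewrite mem_next.
rewrite -IH1; apply: cycle_edges_step => //.
by move: IH2 => /=; rewrite -IH1.
Qed.

Lemma cycle_edges_eq_rot s t : uniq s -> uniq t -> (2 < size t)%N ->
  size s = size t -> cycle_edges t = cycle_edges s ->
  exists b : bool,
    exists2 i, (i < size s)%N & t = rot i (if b then rev s else s).
Proof.
move=> us ut sz esz est.
case dt: t (sz) => [|x t'] // _.
have xt : x \in t by rewrite dt mem_head.
have xs : x \in s.
  have : x \in [set x in t] by rewrite inE.
  by rewrite -cover_cycle_edges est cover_cycle_edges inE.
have sz1 : (1 < size t)%N by rewrite ltnW.
(* Once an orientation of [s] agrees with [t] on the successor of [x], rotating it to start at [x]
   gives [t]. *)
suff [b nb] : exists b : bool, next t x = next (if b then rev s else s) x.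
  exists b; set s1 := if b then _ else _ in nb *.
  have us1 : uniq s1 by rewrite /s1; case: (b); rewrite ?rev_uniq.
  have esz1 : size s1 = size s by rewrite /s1; case: (b); rewrite ?size_rev.
  have xs1 : x \in s1 by rewrite /s1; case: (b); rewrite ?mem_rev.
  have es1 : cycle_edges s1 = cycle_edges s.
    by rewrite /s1; case: (b); rewrite ?cycle_edges_rev.
  exists (index x s1); first by rewrite -esz1 index_mem.
  rewrite -dt; apply: cycle_edges_same_start (rot_index xs1) dt _ ut sz _ _ _.
  - by rewrite rot_uniq.
  - by rewrite size_rot esz1.
  - by rewrite cycle_edges_rot // es1.
  - by rewrite next_rot.
have : [set x; next t x] \in cycle_edges s by rewrite -est; apply: imset_f.
have neqx : next t x != x by apply: uniq_next_neq.
(* This edge of [s] is either the one by which [s] leaves [x], or the one by which [s] enters [x];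
   the latter calls for the reversal. *)
case/imsetP=> u us' exu.
have: x \in [set u; next s u] by rewrite -exu !inE eqxx.
rewrite !inE => /orP[/eqP xu|/eqP xu].
  by exists false; rewrite -xu in exu; apply: set2_inj_l exu.
exists true; rewrite next_rev //; have -> : prev s x = u by rewrite xu prev_next.
by apply: (set2_inj_l neqx); rewrite exu [RHS]setUC -xu.
Qed.

(** The successor of one vertex reveals the orientation, since [next] and [prev] differ there; the
    vertex at position 0 then reveals the offset. *)
Lemma rot_rev_inj s (b c : bool) i j : uniq s -> (2 < size s)%N ->
  (i < size s)%N -> (j < size s)%N ->
  rot i (if b then rev s else s) = rot j (if c then rev s else s) ->
  b = c /\ i = j.
Proof.
move=> us sz li lj e.
have urev : uniq (rev s) by rewrite rev_uniq.
case: s us sz li lj e urev => // x s1; set s := x :: s1 => us sz li lj e urev.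
have xs : x \in s by apply: mem_head.
have nprev : next s x <> prev s x.
  by move=> h; have := uniq_next2_neq us sz xs; rewrite h next_prev // eqxx.
have ebc : b = c.
  have := congr1 (fun t => next t x) e.
  rewrite !next_rot; [|by case: (c)|by case: (b)].
  by case: (b); case: (c); rewrite ?next_rev // => h; case: nprev.
split=> //; move: e; rewrite ebc; set t := if c then _ else _ => e.
have ut : uniq t by rewrite /t; case: (c).
have st : size t = size s by rewrite /t; case: (c); rewrite ?size_rev.
have := congr1 (fun t => nth x t 0) e.
rewrite /rot !nth_cat !size_drop !subn_gt0 st li lj !nth_drop !addn0 => /eqP.
by rewrite nth_uniq ?st // => /eqP.
Qed.

(** Two directions times k starting points, all distinct by [rot_rev_inj] and exhaustive by
    [cycle_edges_eq_rot]. *)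
Lemma card_cycle_edges_fiber (adj : rel 'I_n) k (s : k.-tuple 'I_n) :
  ssrbool.symmetric adj -> (2 < k)%N -> uniq s -> cycle adj s ->
  #|[set t : k.-tuple 'I_n |
      [&& uniq t, cycle adj t & cycle_edges t == cycle_edges s]]| = (2 * k)%N.
Proof.
move=> adj_sym k_gt2 us cs.
pose g (p : bool * 'I_k) : k.-tuple 'I_n :=
  [tuple of rot p.2 (if p.1 then [tuple of rev s] else s)].
have gE p : g p = rot p.2 (if p.1 then rev s else s) :> seq _.
  by case: p => -[] i.
have g_inj : injective g.
  move=> [b i] [c j] /(congr1 (@tval _ _)).
  rewrite [LHS]gE [RHS]gE /= => e.
  have [|||-> /val_inj->] // := rot_rev_inj us _ _ _ e;
  by rewrite ?size_tuple ?ltn_ord.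
transitivity #|[set g p | p in [set: bool * 'I_k]]|; last first.
  by rewrite card_imset // cardsT card_prod card_bool card_ord.
apply: eq_card => t; rewrite inE; apply/and3P/imsetP => [[ut ct /eqP est]|].
  have [||b [i]] := cycle_edges_eq_rot us ut _ _ est; rewrite ?size_tuple //.
  by move=> lti et; exists (b, Ordinal lti) => //; apply: val_inj; rewrite [RHS]gE.
case=> -[b i] _ ->; rewrite gE /= rot_uniq rot_cycle.
split; try by case: b; rewrite ?rev_uniq.
  (* Reversal gives a cycle for the converse relation, which is [adj] again by symmetry. *)
  by case: b => //; rewrite rev_cycle (eq_cycle (e' := adj)) // => x y.
by rewrite cycle_edges_rot; case: b; rewrite ?rev_uniq ?cycle_edges_rev.
Qed.

End CycleEdges.

(** * Squarefree parts, coefficient by coefficient *)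

Section SquareFreePart.
Variables (n : nat) (R : comNzRingType).
Implicit Types (P : {mpoly R[n]}) (m : 'X_{1..n}).

Lemma mcoeff_SF P m :
  (SF P)@_m = if [forall i, (m i <= 1)%N] then P@_m else 0.
Proof.
rewrite /SF raddf_sum /=.
under eq_bigr => m' _ do rewrite mcoeffZ mcoeffX.
have [mP|mP] := boolP (m \in msupp P).
  rewrite big_mkcond (bigD1_seq m) ?msupp_uniq //= eqxx mulr1.
  rewrite big1 ?addr0 // => m' /negbTE->.
  by rewrite mulr0 if_same.
rewrite (memN_msupp_eq0 mP) if_same big_seq_cond big1 // => m' /andP[m'P _].
by case: eqP mP => [<-|]; rewrite ?m'P // mulr0.
Qed.

Lemma SF_sum (I : finType) (F : I -> {mpoly R[n]}) :
  SF (\sum_i F i) = \sum_i SF (F i).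
Proof.
apply/mpolyP=> m; rewrite mcoeff_SF !raddf_sum /=.
under [RHS]eq_bigr => i _ do rewrite mcoeff_SF.
by case: ifP => // _; rewrite big1.
Qed.

Lemma SF_monomial (c : R) m :
  SF (c *: 'X_[m]) = if [forall i, (m i <= 1)%N] then c *: 'X_[m] else 0.
Proof.
apply/mpolyP=> m'; rewrite mcoeff_SF [RHS](fun_if (mcoeff m')) mcoeff0 mcoeffZ mcoeffX.
by case: (m =P m') => [->|]; rewrite ?mulr0 ?if_same.
Qed.

(** The exponent of ['X_x] is the number of occurrences of [x] in [s], so the monomial is squarefree
    exactly when [s] has no repetition. *)
Lemma SF_prodX (c : R) (s : seq 'I_n) :
  SF (c *: \prod_(x <- s) 'X_x) = if uniq s then c *: \prod_(x <- s) 'X_x else 0.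
Proof.
rewrite mprodXE SF_monomial; congr (if _ then _ else _).
have cE x : (\big[mnm_add/mnm0]_(z <- s) U_(z))%MM x = count_mem x s.
  rewrite mnm_sumE -sum1_count [RHS]big_mkcond; apply: eq_bigr => z _.
  by rewrite mnm1E /=; case: eqP.
apply/forallP/idP => [le1|us x]; last by rewrite cE count_uniq_mem // leq_b1.
apply: count_mem_uniq => x; have := le1 x; rewrite cE -has_pred1 has_count.
by case: (count _ _) => [|[]].
Qed.

End SquareFreePart.

(** * Matrix powers as sums over walks *)

Section ClosedWalks.
Variables (n : nat) (R : comNzRingType).
Implicit Types (A : 'M[R]_n) (s : seq 'I_n).

Lemma big_tuple_cons (T : finType) k (F : seq T -> R) :
  \sum_(t : k.+1.-tuple T) F t = \sum_x \sum_(t : k.-tuple T) F (x :: t).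
Proof.
rewrite pair_big /=.
rewrite (reindex (fun p : T * k.-tuple T => cons_tuple p.1 p.2)) //=.
exists (fun t => (thead t, [tuple of behead t])) => [[x t]|t] _.
  by congr pair; apply: val_inj.
by rewrite [RHS]tuple_eta; apply: val_inj.
Qed.

(** Here [s] lists the interior vertices of a walk from [i] to [j]; the induction peels off the
    first step. *)
Lemma mx_expr_walks A k i j :
  (A ^+ k.+1) i j =
  \sum_(s : k.-tuple 'I_n) \prod_(p <- zip (i :: s) (rcons s j)) A p.1 p.2.
Proof.
elim: k i => [|k IHk] i.
  rewrite expr1 (big_pred1 [tuple]) => [|t]; last by apply/esym/eqP/tuple0.
  by rewrite /= big_seq1.
rewrite exprS mxE.
rewrite (big_tuple_cons _ (fun s => \prod_(p <- zip (i :: s) (rcons s j)) A p.1 p.2)).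
apply: eq_bigr => x _; rewrite IHk big_distrr /=.
by apply: eq_bigr => t _; rewrite big_cons.
Qed.

(** Rotation by one pairs the last vertex with the first, closing the walk. At [k = 0] the trace is
    n, whereas the empty tuple contributes only 1. *)
Lemma mxtrace_expr A k : (0 < k)%N ->
  \tr (A ^+ k) = \sum_(t : k.-tuple 'I_n) \prod_(p <- zip t (rot 1 t)) A p.1 p.2.
Proof.
case: k => // k _.
rewrite (big_tuple_cons _ (fun s => \prod_(p <- zip s (rot 1 s)) A p.1 p.2)).
apply: eq_bigr => x _; rewrite mx_expr_walks.
by apply: eq_bigr => t _; rewrite rot1_cons.
Qed.

Variables (adj : rel 'I_n) (wg : {set 'I_n} -> R).

(** Left multiplication by the diagonal matrix makes each step contribute the variable of its
    source, and the sources are the entries of [s]. *)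
Lemma XM_prod (s t : seq 'I_n) : size s = size t ->
  \prod_(p <- zip s t) XM adj wg p.1 p.2 =
  (\prod_(p <- zip s t) wadj adj wg p.1 p.2) *: \prod_(x <- s) 'X_x.
Proof.
elim: s t => [|x s IHs] [|y t] //=; first by rewrite !big_nil scale1r.
case=> /IHs e; rewrite !big_cons e /= /XM /Xmx mul_diag_mx !mxE.
by rewrite [_ * _%:MP]mulrC mul_mpolyC -scalerAl -scalerAr scalerA.
Qed.

Lemma wadj_path_prod x s y :
  \prod_(p <- zip (x :: s) (rcons s y)) wadj adj wg p.1 p.2 =
  if path adj x (rcons s y)
  then \prod_(p <- zip (x :: s) (rcons s y)) wg [set p.1; p.2] else 0.
Proof.
elim: s x => [|z s IHs] x; rewrite /= !big_cons !mxE /=.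
  by rewrite big_nil !mulr1 big_nil mulr1 andbT.
by rewrite IHs; case: (adj x z); case: ifP; rewrite ?mul0r ?mulr0.
Qed.

Lemma wadj_cycle_prod s : uniq s ->
  \prod_(p <- zip s (rot 1 s)) wadj adj wg p.1 p.2 =
  if cycle adj s then \prod_(x <- s) wg [set x; next s x] else 0.
Proof.
move=> us.
have -> : \prod_(x <- s) wg [set x; next s x] =
    \prod_(p <- zip s (rot 1 s)) wg [set p.1; p.2].
  (* Writing [s] as its image under the identity turns the zip into a single map, sending [x] to the
     pair of [x] and [next s x]. *)
  rewrite rot1_next // -{3}(map_id s) zip_map big_map //.
case: s {us} => [|x s]; first by rewrite !big_nil.
by rewrite rot1_cons wadj_path_prod.
Qed.

End ClosedWalks.

(** * Grouping closed walks by cycle *)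

Section WeightedCycles.
Variables (n : nat) (R : comNzRingType) (adj : rel 'I_n).
Variable wg : {set 'I_n} -> R.

Lemma cycle_weight_edges (s : seq 'I_n) : uniq s -> (2 < size s)%N ->
  cycle_weight wg (cycle_edges s) = \prod_(x <- s) wg [set x; next s x].
Proof.
move=> us sz; rewrite /cycle_weight big_imset /=; last exact: cycle_edges_inj.
by rewrite big_uniq.
Qed.

Lemma SF_trace_XM k : ssrbool.symmetric adj -> (2 < k)%N ->
  SF (\tr (XM adj wg ^+ k)) =
    (2 * k)%:R *
      (\sum_(C in simple_cycles adj k)
         cycle_weight wg C *: \prod_(i in cover C) 'X_i).
Proof.
move=> adj_sym k_gt2.
rewrite mxtrace_expr ?(ltn_trans _ k_gt2) // SF_sum.
pose mon C : {mpoly R[n]} := cycle_weight wg C *: \prod_(i in cover C) 'X_i.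
pose scyc (t : k.-tuple 'I_n) := uniq t && cycle adj t.
(* The term of a surviving walk depends only on its edge set, whose cover is the set of vertices
   visited. *)
transitivity (\sum_(t | scyc t) mon (cycle_edges t)).
  rewrite [RHS]big_mkcond; apply: eq_bigr => t _.
  rewrite XM_prod ?size_rot // SF_prodX /scyc.
  case: ifP => //= ut; rewrite wadj_cycle_prod //.
  case: ifP => _; last by rewrite scale0r.
  rewrite /mon cycle_weight_edges ?size_tuple // cover_cycle_edges.
  by congr (_ *: _); rewrite big_uniq //; apply: eq_bigl => x; rewrite inE.
(* Grouped by edge set, the walks fall into classes of 2k members on which the summand is
   constant. *)
rewrite (partition_big (fun t : k.-tuple 'I_n => cycle_edges t)
  (mem (simple_cycles adj k))) /= => [|t /andP[ut ct]]; last first.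
  by rewrite inE; apply/existsP; exists t; rewrite ut ct eqxx.
rewrite mulr_sumr; apply: eq_bigr => C; rewrite inE.
case/existsP=> s /and3P[us cs /eqP defC].
rewrite (eq_bigr (fun=> mon C)) => [|t /andP[_ /eqP->] //].
rewrite sumr_const mulr_natl; congr (_ *+ _).
rewrite -(card_cycle_edges_fiber adj_sym k_gt2 us cs) -defC.
by apply: eq_card => t; rewrite !inE andbA.
Qed.

Lemma sq_trace_XM k : ssrbool.symmetric adj -> (2 < k)%N ->
  sq (\tr (XM adj wg ^+ k)) = (2 * k)%:R * total_cycle_weight adj wg k.
Proof.
move=> adj_sym k_gt2; rewrite /sq SF_trace_XM // rmorphM rmorph_nat raddf_sum /=.
congr (_ * _); apply: eq_bigr => C _.
rewrite mevalZ rmorph_prod /= big1 ?mulr1 // => i _.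
by rewrite mevalXU.
Qed.

End WeightedCycles.

Theorem theorem3p4 (n : nat) (adj : rel 'I_n)
    (adj_sym : ssrbool.symmetric adj) (adj_irr : irreflexive adj)
    (wg : {set 'I_n} -> Zwr) (k : nat) (k_ge3 : (3 <= k)%N) :
  SF (\tr (XM adj wg ^+ k)) =
    (2 * k)%:R *
      (\sum_(C in simple_cycles adj k)
         cycle_weight wg C *: \prod_(i in cover C) 'X_i)
  /\
  Zwr_to_Qwr (total_cycle_weight adj wg k) =
    (2 * k)%:R^-1 *: Zwr_to_Qwr (sq (\tr (XM adj wg ^+ k))).
Proof.
split; first exact: SF_trace_XM.
(* Over the rationals 2k is invertible, so the integral identity can be divided by it. *)
rewrite sq_trace_XM // /Zwr_to_Qwr rmorphM rmorph_nat mulr_natl -scaler_nat.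
rewrite scalerA mulVf ?scale1r // Num.Theory.pnatr_eq0.
by rewrite muln_eq0 /= -lt0n (ltn_trans _ k_ge3).
Qed.
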